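(* Assume $\mathsf{CT_Q}$. Let $\mathcal{M}$ be a model of $\mathsf{HA}$. If $\mathcal{M}>\mathbb{N}$, then $\neg\neg\,\exists d:\mathcal{M}.\ \neg\mathsf{Dec}(\lambda n:\mathbb{N}.\ \mathcal{M}\vDash \overline{n}\mid d)$.
   Context: Meta-theory: constructive type theory (Calculus of Inductive Constructions); propositions in an impredicative universe $\mathbb{P}$, $\exists,\lor$ propositional; no classical axioms assumed. For $p:X\to\mathbb{P}$, $\mathsf{Dec}(p)$ means $\exists f:X\to\mathbb{B}.\ \forall x.\ p\,x\leftrightarrow f\,x=\mathsf{tt}$. Arithmetic signature $0,S,+,\times,=$. $\mathsf{HA}$: axioms $\forall x.\, Sx=0\to\bot$; $\forall xy.\, Sx=Sy\to x=y$; $0+x=x$; $(Sx)+y=S(x+y)$; $0\times x=0$; $(Sx)\times y=y+x\times y$; equality axioms (reflexivity, symmetry, transitivity, congruence for $S,+,\times$); induction scheme for every formula; $\vdash$ is intuitionistic natural deduction. $\mathsf{Q}$: same, induction replaced by $\forall x.\, x=0\lor\exists y.\, x=Sy$. A model $\mathcal{M}$ of $\mathsf{HA}$ is a type with interpretations of $0,S,+,\times$, $=$ interpreted as actual equality, satisfying all $\mathsf{HA}$ axioms under Tarski semantics (connectives/quantifiers interpreted type-theoretically). $\overline{n}$ denotes the numeral $S^n0$ and its value in $\mathcal{M}$; $x\mid y:=\exists k.\,x\times k=y$. $\mathsf{std}(e):=\exists n:\mathbb{N}.\ \overline{n}=e$; $\mathcal{M}>\mathbb{N}$ means $\exists e:\mathcal{M}.\neg\mathsf{std}(e)$.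 A formula is $\Delta_1$ if for every substitution $\sigma$ of closed terms $\mathsf{Q}\vdash\varphi[\sigma]$ or $\mathsf{Q}\vdash\neg\varphi[\sigma]$; $\Sigma_1$ if of the form $\exists x_1\dots\exists x_n.\varphi_0$ with $\varphi_0$ $\Delta_1$. $\mathsf{CT_Q}$: for every $f:\mathbb{N}\to\mathbb{N}$ there is a binary $\Sigma_1$-formula $\varphi_f(x,y)$ with $\mathsf{Q}\vdash\forall y.\,\varphi_f(\overline{n},y)\leftrightarrow\overline{f\,n}=y$ for every $n$. *)

(* Defs.v *)
From Stdlib Require Import List.
Import ListNotations.

Definition Dec {X : Type} (p : X -> Prop) : Prop :=
  exists f : X -> bool, forall x, p x <-> f x = true.

Inductive term : Type :=
| Var (n : nat)
| Zero
| Succ (t : term)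
| Add (s t : term)
| Mul (s t : term).

Inductive form : Type :=
| Bot
| Eq (s t : term)
| And (p q : form)
| Or (p q : form)
| Imp (p q : form)
| All (p : form)
| Ex (p : form).

Definition Neg (p : form) : form := Imp p Bot.
Definition Iff (p q : form) : form := And (Imp p q) (Imp q p).

Definition scons {X : Type} (x : X) (xi : nat -> X) (n : nat) : X :=
  match n with
  | 0 => x
  | S m => xi m
  end.

Fixpoint subst_term (sigma : nat -> term) (t : term) : term :=
  match t with
  | Var n => sigma n
  | Zero => Zero
  | Succ t => Succ (subst_term sigma t)
  | Add s t => Add (subst_term sigma s) (subst_term sigma t)
  | Mul s t => Mul (subst_term sigma s) (subst_term sigma t)
  end.

Definition shift (n : nat) : term := Var (S n).

Definition up (sigma : nat -> term) : nat -> term :=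
  scons (Var 0) (fun n => subst_term shift (sigma n)).

Fixpoint subst (sigma : nat -> term) (p : form) : form :=
  match p with
  | Bot => Bot
  | Eq s t => Eq (subst_term sigma s) (subst_term sigma t)
  | And p q => And (subst sigma p) (subst sigma q)
  | Or p q => Or (subst sigma p) (subst sigma q)
  | Imp p q => Imp (subst sigma p) (subst sigma q)
  | All p => All (subst (up sigma) p)
  | Ex p => Ex (subst (up sigma) p)
  end.

(* All free variables have an index below [n]. *)
Fixpoint bounded_term (n : nat) (t : term) : Prop :=
  match t with
  | Var x => x < n
  | Zero => True
  | Succ t => bounded_term n t
  | Add s t | Mul s t => bounded_term n s /\ bounded_term n t
  end.

Fixpoint bounded (n : nat) (p : form) : Prop :=
  match p with
  | Bot => True
  | Eq s t => bounded_term n s /\ bounded_term n t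
  | And p q | Or p q | Imp p q => bounded n p /\ bounded n q
  | All p | Ex p => bounded (S n) p
  end.

Definition closed_term (t : term) : Prop := bounded_term 0 t.

Fixpoint num (n : nat) : term :=
  match n with
  | 0 => Zero
  | S n => Succ (num n)
  end.

Definition Divides (s t : term) : form :=
  Ex (Eq (Mul (subst_term shift s) (Var 0)) (subst_term shift t)).

Inductive prv : list form -> form -> Prop :=
| prv_ctx A p : In p A -> prv A p
| prv_botE A p : prv A Bot -> prv A p
| prv_impI A p q : prv (p :: A) q -> prv A (Imp p q)
| prv_impE A p q : prv A (Imp p q) -> prv A p -> prv A q
| prv_andI A p q : prv A p -> prv A q -> prv A (And p q)
| prv_andE1 A p q : prv A (And p q) -> prv A p
| prv_andE2 A p q : prv A (And p q) -> prv A q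
| prv_orI1 A p q : prv A p -> prv A (Or p q)
| prv_orI2 A p q : prv A q -> prv A (Or p q)
| prv_orE A p q r :
    prv A (Or p q) -> prv (p :: A) r -> prv (q :: A) r -> prv A r
| prv_allI A p : prv (map (subst shift) A) p -> prv A (All p)
| prv_allE A p t : prv A (All p) -> prv A (subst (scons t Var) p)
| prv_exI A p t : prv A (subst (scons t Var) p) -> prv A (Ex p)
| prv_exE A p q :
    prv A (Ex p) ->
    prv (p :: map (subst shift) A) (subst shift q) ->
    prv A q.

Definition eq_axioms : list form :=
  [ All (Eq (Var 0) (Var 0));
    All (All (Imp (Eq (Var 1) (Var 0)) (Eq (Var 0) (Var 1))));
    All (All (All (Imp (Eq (Var 2) (Var 1))
      (Imp (Eq (Var 1) (Var 0)) (Eq (Var 2) (Var 0))))));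
    All (All (Imp (Eq (Var 1) (Var 0)) (Eq (Succ (Var 1)) (Succ (Var 0)))));
    All (All (All (All (Imp (Eq (Var 3) (Var 2)) (Imp (Eq (Var 1) (Var 0))
      (Eq (Add (Var 3) (Var 1)) (Add (Var 2) (Var 0))))))));
    All (All (All (All (Imp (Eq (Var 3) (Var 2)) (Imp (Eq (Var 1) (Var 0))
      (Eq (Mul (Var 3) (Var 1)) (Mul (Var 2) (Var 0)))))))) ].

Definition arith_axioms : list form :=
  [ All (Imp (Eq (Succ (Var 0)) Zero) Bot);
    All (All (Imp (Eq (Succ (Var 1)) (Succ (Var 0))) (Eq (Var 1) (Var 0))));
    All (Eq (Add Zero (Var 0)) (Var 0));
    All (All (Eq (Add (Succ (Var 1)) (Var 0)) (Succ (Add (Var 1) (Var 0)))));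
    All (Eq (Mul Zero (Var 0)) Zero);
    All (All (Eq (Mul (Succ (Var 1)) (Var 0))
      (Add (Var 0) (Mul (Var 1) (Var 0))))) ].

Definition case_axiom : form :=
  All (Or (Eq (Var 0) Zero) (Ex (Eq (Var 1) (Succ (Var 0))))).

(* The induction variable is index 0; the other free variables of [p] are
   parameters, left free since models satisfy axioms under all assignments. *)
Definition induction (p : form) : form :=
  Imp (subst (scons Zero Var) p)
    (Imp (All (Imp p (subst (scons (Succ (Var 0)) shift) p)))
      (All p)).

Definition Q : list form := eq_axioms ++ arith_axioms ++ [case_axiom].

Inductive HA : form -> Prop :=
| HA_base p : In p (eq_axioms ++ arith_axioms) -> HA p
| HA_induction p : HA (induction p).

Definition Delta1 (p : form) : Prop :=
  forall sigma : nat -> term, (forall n, closed_term (sigma n)) ->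
    prv Q (subst sigma p) \/ prv Q (Neg (subst sigma p)).

Fixpoint exist_times (n : nat) (p : form) : form :=
  match n with
  | 0 => p
  | S n => Ex (exist_times n p)
  end.

Definition Sigma1 (p : form) : Prop :=
  exists n p0, p = exist_times n p0 /\ Delta1 p0.

(* In a binary formula phi(x, y), x is index 0 and y is index 1; substituting
   [num n] for x turns y into index 0, which the outer quantifier binds. *)
Definition CT_Q : Prop :=
  forall f : nat -> nat, exists p : form,
    bounded 2 p /\ Sigma1 p /\
    forall n : nat,
      prv Q (All (Iff (subst (scons (num n) Var) p) (Eq (num (f n)) (Var 0)))).

Record structure : Type := Structure {
  carrier :> Type;
  izero : carrier;
  isucc : carrier -> carrier;
  iadd : carrier -> carrier -> carrier;
  imul : carrier -> carrier -> carrier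
}.

Fixpoint eval (M : structure) (rho : nat -> M) (t : term) : M :=
  match t with
  | Var n => rho n
  | Zero => izero M
  | Succ t => isucc M (eval M rho t)
  | Add s t => iadd M (eval M rho s) (eval M rho t)
  | Mul s t => imul M (eval M rho s) (eval M rho t)
  end.

Fixpoint sat (M : structure) (rho : nat -> M) (p : form) : Prop :=
  match p with
  | Bot => False
  | Eq s t => eval M rho s = eval M rho t
  | And p q => sat M rho p /\ sat M rho q
  | Or p q => sat M rho p \/ sat M rho q
  | Imp p q => sat M rho p -> sat M rho q
  | All p => forall x : M, sat M (scons x rho) p
  | Ex p => exists x : M, sat M (scons x rho) p
  end.

Definition HA_model (M : structure) : Prop :=
  forall p, HA p -> forall rho, sat M rho p.

(* Numerals are closed, so the assignment is irrelevant. *)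
Definition num_val (M : structure) (n : nat) : M :=
  eval M (fun _ => izero M) (num n).

Definition std (M : structure) (e : M) : Prop :=
  exists n : nat, num_val M n = e.

Definition nonstandard (M : structure) : Prop :=
  exists e : M, ~ std M e.

(* Main.v *)
(** Let [A] (resp. [B]) be the set of [u] such that Q proves that the [u]-th
    formula represents the value 1 (resp. 0) at argument [u]. Searching through
    derivations enumerates both sets, and they are inseparable. Attach to [u]
    the [u]-th member [q u] of a pairwise coprime sequence, and let [fA], [fB]
    enumerate the [q u] with [u] in [A], resp. [B]. For each standard [n] the
    product of the [fA k], [k < n], is divisible by every [fA k] and by no
    [fB k], [k < n]. By CT_Q this is expressible in M, and overspill yields one
    [d] with this property for all standard [k]. A decider for the standard
    divisors of [d] would separate [A] from [B]; the formula that CT_Q assigns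
    to this separation is refuted at its own index. *)

From Stdlib Require Import List Arith Lia Cantor.
Import ListNotations.
Require Import Defs.

(** * Enumeration of the theorems of Q *)

Inductive tree : Type :=
| Leaf
| Node (n : nat) (a b c d : tree).

(** [fuel] makes the recursion structural; [nth_tree] reads it off the index, so every tree is
    reached with enough of it. *)
Fixpoint tree_of_nat (fuel m : nat) : tree :=
  match fuel, m with
  | S k, S m =>
      let (n, m) := of_nat m in
      let (a, m) := of_nat m in
      let (b, m) := of_nat m in
      let (c, d) := of_nat m in
      Node n (tree_of_nat k a) (tree_of_nat k b)
             (tree_of_nat k c) (tree_of_nat k d)
  | _, _ => Leaf
  end.

Definition nth_tree (m : nat) : tree :=
  let (k, m) := of_nat m in tree_of_nat k m.

Lemma nth_tree_surj t : exists m, nth_tree m = t.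
Proof.
  (* Asking for all large enough fuels lets the four subtrees share one fuel. *)
  enough (H : exists k0 m, forall k, k0 <= k -> tree_of_nat k m = t).
  { destruct H as (k & m & H). exists (to_nat (k, m)).
    unfold nth_tree. rewrite cancel_of_to. auto. }
  induction t as [|n a (ka & ma & Ha) b (kb & mb & Hb)
                    c (kc & mc & Hc) d (kd & md & Hd)].
  - exists 0, 0. now intros [|k].
  - exists (S (ka + kb + kc + kd)).
    exists (S (to_nat (n, to_nat (ma, to_nat (mb, to_nat (mc, md)))))).
    intros [|k] Hk; [lia|].
    cbn [tree_of_nat]. rewrite !cancel_of_to.
    now rewrite Ha, Hb, Hc, Hd by lia.
Qed.

Fixpoint decode_term (t : tree) : term :=
  match t with
  | Leaf => Zero
  | Node 0 a _ _ _ => Succ (decode_term a)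
  | Node 1 a b _ _ => Add (decode_term a) (decode_term b)
  | Node 2 a b _ _ => Mul (decode_term a) (decode_term b)
  | Node (S (S (S n))) _ _ _ _ => Var n
  end.

Lemma decode_term_surj s : exists t, decode_term t = s.
Proof.
  induction s as [n| |s [a <-]|s [a <-] s' [b <-]|s [a <-] s' [b <-]].
  - now exists (Node (S (S (S n))) Leaf Leaf Leaf Leaf).
  - now exists Leaf.
  - now exists (Node 0 a Leaf Leaf Leaf).
  - now exists (Node 1 a b Leaf Leaf).
  - now exists (Node 2 a b Leaf Leaf).
Qed.

Fixpoint decode_form (t : tree) : form :=
  match t with
  | Leaf => Bot
  | Node 0 a b _ _ => Eq (decode_term a) (decode_term b)
  | Node 1 a b _ _ => And (decode_form a) (decode_form b)
  | Node 2 a b _ _ => Or (decode_form a) (decode_form b)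
  | Node 3 a b _ _ => Imp (decode_form a) (decode_form b)
  | Node 4 a _ _ _ => All (decode_form a)
  | Node _ a _ _ _ => Ex (decode_form a)
  end.

Lemma decode_form_surj p : exists t, decode_form t = p.
Proof.
  induction p as [|s t|p [a <-] q [b <-]|p [a <-] q [b <-]
                 |p [a <-] q [b <-]|p [a <-]|p [a <-]].
  - now exists Leaf.
  - destruct (decode_term_surj s) as [a <-], (decode_term_surj t) as [b <-].
    now exists (Node 0 a b Leaf Leaf).
  - now exists (Node 1 a b Leaf Leaf).
  - now exists (Node 2 a b Leaf Leaf).
  - now exists (Node 3 a b Leaf Leaf).
  - now exists (Node 4 a Leaf Leaf Leaf).
  - now exists (Node 5 a Leaf Leaf Leaf).
Qed.

Lemma form_eq_dec (p q : form) : {p = q} + {p <> q}.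
Proof. repeat decide equality. Defined.

(* Checks a natural deduction derivation; the node label is the last rule, and
   the premise formulas and terms that cannot be read off the conclusion are
   stored in the first subtrees. *)
Fixpoint check (t : tree) (A : list form) (p : form) : bool :=
  match t with
  | Leaf => if in_dec form_eq_dec p A then true else false
  | Node 0 a _ _ _ => check a A Bot
  | Node 1 a _ _ _ =>
      match p with Imp p q => check a (p :: A) q | _ => false end
  | Node 2 a b c _ =>
      check b A (Imp (decode_form a) p) && check c A (decode_form a)
  | Node 3 a b _ _ =>
      match p with And p q => check a A p && check b A q | _ => false end
  | Node 4 a b _ _ => check b A (And p (decode_form a))
  | Node 5 a b _ _ => check b A (And (decode_form a) p)
  | Node 6 a _ _ _ => match p with Or p q => check a A p | _ => false end
  | Node 7 a _ _ _ => match p with Or p q => check a A q | _ => false end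
  | Node 8 a b c d =>
      match decode_form a with
      | Or q r => check b A (Or q r) && (check c (q :: A) p && check d (r :: A) p)
      | _ => false
      end
  | Node 9 a _ _ _ =>
      match p with All p => check a (map (subst shift) A) p | _ => false end
  | Node 10 a b c _ =>
      check c A (All (decode_form a)) &&
      if form_eq_dec p (subst (scons (decode_term b) Var) (decode_form a))
      then true else false
  | Node 11 a b _ _ =>
      match p with
      | Ex p => check b A (subst (scons (decode_term a) Var) p)
      | _ => false
      end
  | Node _ a b c _ =>
      check b A (Ex (decode_form a)) &&
      check c (decode_form a :: map (subst shift) A) (subst shift p)
  end%bool.

Lemma check_sound t A p : check t A p = true -> prv A p.
Proof.
  revert A p; induction t as [|n a IHa b IHb c IHc d IHd]; intros A p.
  - cbn. destruct in_dec; [now constructor|discriminate].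
  (* Labels 0 to 11 are split off; all larger ones check existential elimination. *)
  - do 12 try destruct n as [|n]; cbn [check]; intros H.
    + now apply prv_botE, IHa.
    + destruct p; try discriminate. now apply prv_impI, IHa.
    + apply andb_prop in H as [H1 H2]. eapply prv_impE; eauto.
    + destruct p; try discriminate.
      apply andb_prop in H as [H1 H2]. apply prv_andI; auto.
    + eapply prv_andE1; eauto.
    + eapply prv_andE2; eauto.
    + destruct p; try discriminate. now apply prv_orI1, IHa.
    + destruct p; try discriminate. now apply prv_orI2, IHa.
    + destruct (decode_form a); try discriminate.
      apply andb_prop in H as [H1 H]. apply andb_prop in H as [H2 H3].
      eapply prv_orE; eauto.
    + destruct p; try discriminate. now apply prv_allI, IHa.
    + apply andb_prop in H as [H1 H2].
      destruct form_eq_dec as [->|]; [|discriminate]. now apply prv_allE, IHc.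
    + destruct p; try discriminate. eapply prv_exI; eauto.
    + apply andb_prop in H as [H1 H2]. eapply prv_exE; eauto.
Qed.

Lemma check_complete A p : prv A p -> exists t, check t A p = true.
Proof.
  induction 1 as
    [A p Hp|A p _ [a IHa]|A p q _ [a IHa]|A p q _ [b IHb] _ [c IHc]
    |A p q _ [a IHa] _ [b IHb]|A p q _ [b IHb]|A p q _ [b IHb]
    |A p q _ [a IHa]|A p q _ [a IHa]|A p q r _ [b IHb] _ [c IHc] _ [d IHd]
    |A p _ [a IHa]|A p t _ [c IHc]|A p t _ [b IHb]|A p q _ [b IHb] _ [c IHc]].
  - exists Leaf. cbn. now destruct in_dec.
  - now exists (Node 0 a Leaf Leaf Leaf).
  - now exists (Node 1 a Leaf Leaf Leaf).
  - destruct (decode_form_surj p) as [a <-].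
    exists (Node 2 a b c Leaf). cbn [check]. now rewrite IHb, IHc.
  - exists (Node 3 a b Leaf Leaf). cbn [check]. now rewrite IHa, IHb.
  - destruct (decode_form_surj q) as [a <-]. now exists (Node 4 a b Leaf Leaf).
  - destruct (decode_form_surj p) as [a <-]. now exists (Node 5 a b Leaf Leaf).
  - now exists (Node 6 a Leaf Leaf Leaf).
  - now exists (Node 7 a Leaf Leaf Leaf).
  - destruct (decode_form_surj (Or p q)) as [a Ha].
    exists (Node 8 a b c d). cbn [check]. now rewrite Ha, IHb, IHc, IHd.
  - now exists (Node 9 a Leaf Leaf Leaf).
  - destruct (decode_form_surj p) as [a <-], (decode_term_surj t) as [b <-].
    exists (Node 10 a b c Leaf). cbn [check]. rewrite IHc.
    now destruct form_eq_dec.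
  - destruct (decode_term_surj t) as [a <-]. now exists (Node 11 a b Leaf Leaf).
  - destruct (decode_form_surj p) as [a <-].
    exists (Node 12 a b c Leaf). cbn [check]. now rewrite IHb, IHc.
Qed.

(** * Diagonal sentences and their enumeration *)

Definition nth_form (u : nat) : form := decode_form (nth_tree u).

Lemma nth_form_surj p : exists u, nth_form u = p.
Proof.
  destruct (decode_form_surj p) as [t <-], (nth_tree_surj t) as [u <-].
  now exists u.
Qed.

Definition represents_at (p : form) (n v : nat) : form :=
  All (Iff (subst (scons (num n) Var) p) (Eq (num v) (Var 0))).

Definition diag (v u : nat) : form := represents_at (nth_form u) u v.

(* Enumerates [g u] for the [u] such that Q proves [diag v u], with [default]
   at the stages at which nothing is found. *)
Definition enum_diag (v default : nat) (g : nat -> nat) (k : nat) : nat :=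
  let (c, u) := of_nat k in
  if check (nth_tree c) Q (diag v u) then g u else default.

(** A stage codes a pair of a derivation and [u], so a derivation of [diag v u] yields the stage. *)
Lemma enum_diag_complete v default g u :
  prv Q (diag v u) -> exists k, enum_diag v default g k = g u.
Proof.
  intros [t Ht]%check_complete. destruct (nth_tree_surj t) as [c <-].
  exists (to_nat (c, u)). unfold enum_diag. now rewrite cancel_of_to, Ht.
Qed.

Lemma enum_diag_sound v default g k :
  enum_diag v default g k = default \/
  exists u, enum_diag v default g k = g u /\ prv Q (diag v u).
Proof.
  unfold enum_diag. destruct (of_nat k) as [c u].
  destruct check eqn:H; [right|now left].
  exists u. split; [easy|]. now apply check_sound in H.
Qed.

(** * A pairwise coprime sequence *)

(** Sylvester's sequence 2, 3, 7, 43, ... less one: each value is the product of all earlier terms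
    of [sylvester]. *)
Fixpoint sylvester_pred (n : nat) : nat :=
  match n with
  | 0 => 1
  | S n => sylvester_pred n * S (sylvester_pred n)
  end.

Definition sylvester (n : nat) : nat := S (sylvester_pred n).

Lemma sylvester_gt1 n : 1 < sylvester n.
Proof. unfold sylvester. induction n; cbn [sylvester_pred]; nia. Qed.

Lemma sylvester_divide_pred m n :
  m < n -> Nat.divide (sylvester m) (sylvester_pred n).
Proof.
  induction 1 as [|n _ IH]; cbn [sylvester_pred].
  - now exists (sylvester_pred m).
  - now apply Nat.divide_mul_l.
Qed.

(** A common divisor divides both [sylvester n] and its predecessor, hence their difference 1. *)
Lemma sylvester_coprime_lt m n :
  m < n -> Nat.gcd (sylvester m) (sylvester n) = 1.
Proof.
  intros H%sylvester_divide_pred.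
  apply Nat.divide_1_r.
  assert (H1 := Nat.gcd_divide_l (sylvester m) (sylvester n)).
  assert (H2 := Nat.gcd_divide_r (sylvester m) (sylvester n)).
  replace 1 with (sylvester n - sylvester_pred n) by (unfold sylvester; lia).
  apply Nat.divide_sub_r; [easy|]. now transitivity (sylvester m).
Qed.

Lemma sylvester_coprime m n :
  m <> n -> Nat.gcd (sylvester m) (sylvester n) = 1.
Proof.
  intros H. destruct (Nat.lt_gt_cases m n) as [Hl _].
  destruct (Hl H); [|rewrite Nat.gcd_comm]; now apply sylvester_coprime_lt.
Qed.

(** * Finite products *)

Fixpoint prod_below (f : nat -> nat) (n : nat) : nat :=
  match n with
  | 0 => 1
  | S n => f n * prod_below f n
  end.

Lemma divide_prod_below f k n : k < n -> Nat.divide (f k) (prod_below f n).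
Proof.
  induction 1; cbn [prod_below].
  - apply Nat.divide_factor_l.
  - now apply Nat.divide_mul_r.
Qed.

Lemma prod_below_coprime f q n :
  (forall k, Nat.gcd q (f k) = 1) -> Nat.gcd q (prod_below f n) = 1.
Proof.
  intros H. induction n as [|n IH]; cbn [prod_below].
  - apply Nat.divide_1_r, Nat.gcd_divide_r.
  - apply Nat.divide_1_r. rewrite <- IH. apply Nat.gcd_greatest.
    + apply Nat.gcd_divide_l.
    (* The gcd divides [q], so it is coprime to [f n] and must divide the remaining product. *)
    + apply Nat.gauss with (f n).
      * apply Nat.gcd_divide_r.
      * apply Nat.divide_1_r. rewrite <- (H n). apply Nat.gcd_greatest.
        -- etransitivity; [apply Nat.gcd_divide_l|apply Nat.gcd_divide_l].
        -- apply Nat.gcd_divide_r.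
Qed.

Lemma prod_below_pos f n : (forall k, f k <> 0) -> prod_below f n <> 0.
Proof.
  intros H. induction n as [|n IH]; cbn [prod_below]; [easy|].
  specialize (H n). nia.
Qed.

(** * Soundness *)

Lemma eval_ext (M : structure) (rho rho' : nat -> M) t :
  (forall n, rho n = rho' n) -> eval M rho t = eval M rho' t.
Proof. intros H. induction t; cbn; congruence. Qed.

Lemma sat_ext (M : structure) (rho rho' : nat -> M) p :
  (forall n, rho n = rho' n) -> sat M rho p <-> sat M rho' p.
Proof.
  revert rho rho'.
  induction p as [|s t|p IHp q IHq|p IHp q IHq|p IHp q IHq|p IHp|p IHp];
    intros rho rho' H; cbn.
  - easy.
  - now rewrite (eval_ext _ _ _ s H), (eval_ext _ _ _ t H).
  - now rewrite (IHp _ _ H), (IHq _ _ H).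
  - now rewrite (IHp _ _ H), (IHq _ _ H).
  - now rewrite (IHp _ _ H), (IHq _ _ H).
  - split; intros Hp x; (eapply IHp; [|apply (Hp x)]); intros [|n]; cbn; auto.
  - split; intros [x Hp]; exists x; (eapply IHp; [|apply Hp]);
      intros [|n]; cbn; auto.
Qed.

Lemma eval_subst (M : structure) (rho : nat -> M) sigma t :
  eval M rho (subst_term sigma t) = eval M (fun n => eval M rho (sigma n)) t.
Proof. induction t; cbn; congruence. Qed.

Lemma eval_up (M : structure) (rho : nat -> M) sigma x n :
  eval M (scons x rho) (up sigma n) =
  scons x (fun n => eval M rho (sigma n)) n.
Proof. destruct n; cbn; [easy|]. now rewrite eval_subst. Qed.

Lemma sat_subst (M : structure) (rho : nat -> M) sigma p :
  sat M rho (subst sigma p) <-> sat M (fun n => eval M rho (sigma n)) p.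
Proof.
  revert rho sigma.
  induction p as [|s t|p IHp q IHq|p IHp q IHq|p IHp q IHq|p IHp|p IHp];
    intros rho sigma; cbn.
  - easy.
  - now rewrite !eval_subst.
  - now rewrite IHp, IHq.
  - now rewrite IHp, IHq.
  - now rewrite IHp, IHq.
  - split; intros H x; specialize (H x);
      [rewrite IHp in H|rewrite IHp]; (eapply sat_ext; [|apply H]);
      intros n; cbv beta; now rewrite eval_up.
  - split; intros [x H]; exists x;
      [rewrite IHp in H|rewrite IHp]; (eapply sat_ext; [|apply H]);
      intros n; cbv beta; now rewrite eval_up.
Qed.

Lemma sat_shift (M : structure) (rho : nat -> M) x p :
  sat M (scons x rho) (subst shift p) <-> sat M rho p.
Proof. rewrite sat_subst. now apply sat_ext. Qed.

Lemma sat_inst (M : structure) (rho : nat -> M) t p :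
  sat M rho (subst (scons t Var) p) <-> sat M (scons (eval M rho t) rho) p.
Proof. rewrite sat_subst. apply sat_ext. now intros [|n]. Qed.

Lemma soundness (M : structure) A p :
  prv A p -> forall rho : nat -> M,
    (forall q, In q A -> sat M rho q) -> sat M rho p.
Proof.
  assert (Hcons : forall (rho : nat -> M) p A, sat M rho p ->
    (forall q, In q A -> sat M rho q) ->
    forall q, In q (p :: A) -> sat M rho q).
  { intros rho q B Hq HB r [<-|Hr]; auto. }
  assert (Hmap : forall (rho : nat -> M) A x,
    (forall q, In q A -> sat M rho q) ->
    forall q, In q (map (subst shift) A) -> sat M (scons x rho) q).
  { intros rho B x HB q (r & <- & Hr)%in_map_iff. apply sat_shift. auto. }
  induction 1 as
    [A p Hp|A p _ IH|A p q _ IH|A p q _ IH1 _ IH2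
    |A p q _ IH1 _ IH2|A p q _ IH|A p q _ IH
    |A p q _ IH|A p q _ IH|A p q r _ IH _ IH1 _ IH2
    |A p _ IH|A p t _ IH|A p t _ IH|A p q _ IH1 _ IH2]; intros rho HA.
  - auto.
  - now destruct (IH rho HA).
  - intros Hp. now apply IH, Hcons.
  - exact (IH1 rho HA (IH2 rho HA)).
  - split; [now apply IH1|now apply IH2].
  - apply (IH rho HA).
  - apply (IH rho HA).
  - left. now apply IH.
  - right. now apply IH.
  - destruct (IH rho HA); [apply IH1|apply IH2]; now apply Hcons.
  - intros x. now apply IH, Hmap.
  - apply sat_inst, (IH rho HA).
  - exists (eval M rho t). apply sat_inst, (IH rho HA).
  - destruct (IH1 rho HA) as [x Hx]. apply (sat_shift M rho x), IH2.
    apply Hcons; [exact Hx|now apply Hmap].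
Qed.

(** * Models of HA *)

Lemma eval_num (M : structure) (rho : nat -> M) n : eval M rho (num n) = num_val M n.
Proof. unfold num_val. induction n; cbn; congruence. Qed.

Lemma sat_divides (M : structure) (rho : nat -> M) s t :
  sat M rho (Divides s t) <->
  exists x, imul M (eval M rho s) x = eval M rho t.
Proof.
  unfold Divides; cbn. split; intros [x Hx]; exists x;
    rewrite !eval_subst in *; exact Hx.
Qed.

Section Model.

Variables (M : structure) (HM : HA_model M).

Local Notation "0" := (izero M).
Local Notation S' := (isucc M).
Local Notation "x + y" := (iadd M x y).
Local Notation "x * y" := (imul M x y).
Local Notation nv := (num_val M).

Lemma model_induction p (rho : nat -> M) :
  sat M (scons 0 rho) p ->
  (forall x, sat M (scons x rho) p -> sat M (scons (S' x) rho) p) ->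
  forall x, sat M (scons x rho) p.
Proof.
  intros H0 HS. apply (HM _ (HA_induction p) rho).
  - now apply sat_inst.
  - intros x Hx. apply sat_subst. eapply sat_ext; [|apply (HS x Hx)].
    now intros [|n].
Qed.

Lemma model_axiom p : In p (eq_axioms ++ arith_axioms) -> sat M (fun _ => 0) p.
Proof. intros H. now apply HM, HA_base. Qed.

(** [n] is a position in the list of axioms; the six equality axioms come first, so arithmetic
    starts at 6. *)
Local Ltac ax n :=
  refine (model_axiom (nth n (eq_axioms ++ arith_axioms) Bot) _);
  apply nth_In; cbn; lia.

Lemma succ_neq_zero : forall x, S' x <> 0.
Proof. ax 6. Qed.

Lemma succ_inj : forall x y, S' x = S' y -> x = y.
Proof. ax 7. Qed.

Lemma zero_add : forall x, 0 + x = x.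
Proof. ax 8. Qed.

Lemma succ_add : forall x y, S' x + y = S' (x + y).
Proof. ax 9. Qed.

Lemma zero_mul : forall x, 0 * x = 0.
Proof. ax 10. Qed.

Lemma succ_mul : forall x y, S' x * y = y + x * y.
Proof. ax 11. Qed.

(** The case axiom of Q, recovered by induction so that [M] satisfies all theorems of Q. *)
Lemma zero_or_succ x : x = 0 \/ exists y, x = S' y.
Proof.
  apply (model_induction
    (Or (Eq (Var 0) Zero) (Ex (Eq (Var 1) (Succ (Var 0))))) (fun _ => 0)).
  - now left.
  - intros y _. right. now exists y.
Qed.

Lemma sat_Q (rho : nat -> M) p : prv Q p -> sat M rho p.
Proof.
  intros H. apply (soundness _ _ _ H). intros q Hq.
  unfold Q in Hq. rewrite app_assoc in Hq.
  apply in_app_iff in Hq as [Hq|[<-|[]]].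
  - now apply HM, HA_base.
  - exact zero_or_succ.
Qed.

(** Carries [CT_Q] into [M]: at a standard argument the formula defines the numeral of the value,
    even among nonstandard [y]. *)
Lemma represents_at_sat (rho : nat -> M) p n v :
  prv Q (represents_at p n v) ->
  forall y, sat M (scons (nv n) (scons y rho)) p <-> nv v = y.
Proof.
  intros H y. assert (Hy := sat_Q rho _ H y). cbn in Hy.
  rewrite sat_inst, !eval_num in Hy. exact Hy.
Qed.

(** * Numerals in the model *)

Lemma num_val_inj m n : nv m = nv n -> m = n.
Proof.
  revert n; induction m as [|m IH]; intros [|n] H.
  - easy.
  - now destruct (succ_neq_zero (nv n)).
  - now destruct (succ_neq_zero (nv m)).
  - f_equal. now apply IH, succ_inj.
Qed.

Lemma num_val_add m n : nv (m + n)%nat = nv m + nv n.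
Proof.
  induction m as [|m IH].
  - symmetry. apply zero_add.
  - change (S' (nv (m + n)%nat) = S' (nv m) + nv n).
    now rewrite succ_add, IH.
Qed.

Lemma num_val_mul m n : nv (m * n)%nat = nv m * nv n.
Proof.
  induction m as [|m IH].
  - symmetry. apply zero_mul.
  - change (nv (n + m * n)%nat = S' (nv m) * nv n).
    now rewrite succ_mul, num_val_add, IH.
Qed.

(** The equation expresses [x < n]. Peeling successors off both sides ends at [x = 0] after finitely
    many steps, so only numerals lie below a numeral. *)
Lemma lt_num_val x z n : S' x + z = nv n -> exists k, k < n /\ x = nv k.
Proof.
  revert x; induction n as [|n IH]; intros x H; rewrite succ_add in H.
  - now destruct (succ_neq_zero _ H).
  - apply succ_inj in H.
    destruct (zero_or_succ x) as [->|[y ->]].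
    + exists 0%nat. split; [lia|easy].
    + destruct (IH y H) as (k & Hk & ->). exists (S k). split; [lia|easy].
Qed.

(** A nonstandard element is the successor of a nonstandard one, so any finite number of successors
    can be peeled off. *)
Lemma num_val_lt_nonstandard e k : ~ std M e -> exists z, S' (nv k) + z = e.
Proof.
  revert e; induction k as [|k IH]; intros e He.
  - destruct (zero_or_succ e) as [->|[y ->]].
    + destruct He. now exists 0%nat.
    + exists y. rewrite succ_add. f_equal. apply zero_add.
  - destruct (zero_or_succ e) as [->|[y ->]].
    + destruct He. now exists 0%nat.
    + destruct (IH y) as [z <-].
      * intros [n <-]. apply He. now exists (S n).
      * exists z. now rewrite succ_add.
Qed.

(** For nonzero [a] the quotient is at most [nv b], hence a numeral, and the equation descends to
    [nat]. *)
Lemma divide_num_val a b x : b <> 0%nat -> nv a * x = nv b -> Nat.divide a b.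
Proof.
  intros Hb H. destruct a as [|a].
  - change (0 * x = nv b) in H. rewrite zero_mul in H.
    destruct Hb. symmetry. now apply (num_val_inj 0).
  - assert (Hx : S' x + nv a * x = nv (S b)).
    { rewrite succ_add, <- succ_mul. cbn in *. now f_equal. }
    apply lt_num_val in Hx as (c & _ & ->).
    rewrite <- num_val_mul in H. apply num_val_inj in H.
    exists c. lia.
Qed.

(** If [p] failed at all nonstandard elements, induction would carry its double negation from 0 up
    to [e]. Inducting on [Neg (Neg p)] makes each goal [False], where [~ ~ std M x] serves as
    [std M x]. *)
Lemma overspill (p : form) (rho : nat -> M) :
  nonstandard M ->
  (forall n, sat M (scons (nv n) rho) p) ->
  ~ ~ exists e, ~ std M e /\ sat M (scons e rho) p.
Proof.
  intros [e He] Hp H.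
  apply (model_induction (Neg (Neg p)) rho) with (x := e); cbn.
  - intros Hn. apply Hn, (Hp 0%nat).
  - intros x Hx HSx. apply Hx. intros Hx'.
    apply H. exists x. split; [|exact Hx'].
    intros [n <-]. apply HSx, (Hp (S n)).
  - intros Hpe. apply H. now exists e.
Qed.

(** The model supplies the consistency of Q: the value at [u] would be both numerals. *)
Lemma diag_disjoint u : prv Q (diag 0%nat u) -> prv Q (diag 1 u) -> False.
Proof.
  intros H0 H1.
  assert (E : nv 1 = nv 0).
  { apply (represents_at_sat (fun _ => 0) _ _ _ H1).
    now apply (represents_at_sat (fun _ => 0) _ _ _ H0). }
  now apply num_val_inj in E.
Qed.

(* Under the binders, [y], [z], [k], [d] and the free variable [v] have indices
   0, ..., 4; [z] witnesses [k < v], and [y] is the value at [k]. *)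
Definition separator (pA pB : form) : form :=
  Ex (All (All (Imp (Eq (Add (Succ (Var 1)) (Var 0)) (Var 3))
    (All (And
      (Imp (subst (scons (Var 2) (scons (Var 0) Var)) pA)
        (Divides (Var 0) (Var 3)))
      (Imp (subst (scons (Var 2) (scons (Var 0) Var)) pB)
        (Neg (Divides (Var 0) (Var 3))))))))).

Lemma sat_subst_vars (rho : nat -> M) i j p :
  sat M rho (subst (scons (Var i) (scons (Var j) Var)) p) <->
  sat M (scons (rho i) (scons (rho j) rho)) p.
Proof. rewrite sat_subst. apply sat_ext. now intros [|[|n]]. Qed.

Section Separator.

Variables (pA pB : form) (fA fB : nat -> nat).
Hypothesis HA : forall n, prv Q (represents_at pA n (fA n)).
Hypothesis HB : forall n, prv Q (represents_at pB n (fB n)).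

(** Every numeral lies below the nonstandard [e], so the guard of [separator] holds at all standard
    [k]. *)
Lemma separator_elim (rho : nat -> M) e :
  ~ std M e -> sat M (scons e rho) (separator pA pB) ->
  exists d, forall k,
    (exists x, nv (fA k) * x = d) /\ ~ (exists x, nv (fB k) * x = d).
Proof.
  intros He [d Hd]. exists d. intros k.
  destruct (num_val_lt_nonstandard e k He) as [z Hz].
  split.
  - destruct (Hd (nv k) z Hz (nv (fA k))) as [H _]. apply sat_divides in H; [exact H|].
    apply sat_subst_vars. now apply (represents_at_sat _ _ _ _ (HA k)).
  - destruct (Hd (nv k) z Hz (nv (fB k))) as [_ H]. intros Hx.
    apply H; [|now apply sat_divides].
    apply sat_subst_vars. now apply (represents_at_sat _ _ _ _ (HB k)).
Qed.

(** Only numerals lie below [nv n], so the conditions in [nat] suffice; [d <> 0] lets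
    [divide_num_val] transfer non-divisibility. *)
Lemma separator_num_val (rho : nat -> M) n d :
  d <> 0%nat ->
  (forall k, k < n -> Nat.divide (fA k) d) ->
  (forall k, k < n -> ~ Nat.divide (fB k) d) ->
  sat M (scons (nv n) rho) (separator pA pB).
Proof.
  intros Hd HdA HdB. exists (nv d). intros x z Hz y.
  apply (lt_num_val x) in Hz as (k & Hk & ->). split; intros H.
  - apply sat_subst_vars, (represents_at_sat _ _ _ _ (HA k) y) in H as <-.
    apply sat_divides. destruct (HdA k Hk) as [c ->].
    exists (nv c). cbn. now rewrite <- num_val_mul, Nat.mul_comm.
  - apply sat_subst_vars, (represents_at_sat _ _ _ _ (HB k) y) in H as <-.
    intros [c Hc]%(sat_divides _ _ (Var 0) (Var 3)). exact (HdB k Hk (divide_num_val _ _ c Hd Hc)).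
Qed.

End Separator.

End Model.

(** * Overspill and diagonalization *)

Theorem theorem7p21 (ct : CT_Q) (M : structure) (HM : HA_model M)
    (Hns : nonstandard M) :
  ~ ~ exists d : M,
        ~ Dec (fun n : nat => sat M (fun _ => d) (Divides (num n) (Var 0))).
Proof.
  (* The defaults 1 and 0 make both divisibility conditions on [d <> 0] void. *)
  set (fA := enum_diag 1 1 sylvester).
  set (fB := enum_diag 0 0 sylvester).
  destruct (ct fA) as (pA & _ & _ & HA), (ct fB) as (pB & _ & _ & HB).
  intros Hd.
  apply (overspill M HM (separator pA pB) (fun _ => izero M) Hns).
  - intros n.
    assert (Hpos : prod_below fA n <> 0).
    { apply prod_below_pos. intros k.
      destruct (enum_diag_sound 1 1 sylvester k) as [H|(u & H & _)];
        unfold fA; now rewrite H. }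
    apply (separator_num_val M HM pA pB fA fB HA HB _ n (prod_below fA n)).
    + exact Hpos.
    + intros k Hk. now apply divide_prod_below.
    + intros k _ Hdiv.
      destruct (enum_diag_sound 0 0 sylvester k) as [H|(u & H & Hu)];
        fold fB in H; rewrite H in Hdiv.
      * now apply Nat.divide_0_l in Hdiv.
      (* Each factor [fA j] is 1 or [sylvester w] with [diag 1 w] provable; as [diag 0 u] is
         provable, [w] differs from [u]. *)
      * assert (Hgcd : Nat.gcd (sylvester u) (prod_below fA n) = 1).
        { apply prod_below_coprime. intros j.
          destruct (enum_diag_sound 1 1 sylvester j) as [Hj|(w & Hj & Hw)];
            unfold fA; rewrite Hj.
          - apply Nat.divide_1_r, Nat.gcd_divide_r.
          - apply sylvester_coprime. intros <-.
            exact (diag_disjoint M HM u Hu Hw). }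
        apply Nat.divide_gcd_iff in Hdiv.
        assert (H1 := sylvester_gt1 u). lia.
  - intros (e & He & Hsep).
    apply (separator_elim M HM pA pB fA fB HA HB) in Hsep as [d Hsep]; [|easy].
    apply Hd. exists d. intros [f Hf].
    assert (Hdiv : forall n,
              f n = true <-> exists x, imul M (num_val M n) x = d).
    { intros n. rewrite <- Hf, sat_divides. cbn. now rewrite eval_num. }
    (* [g] answers against the decider. At the index [u] of its own formula, [g u = 0] makes
       [sylvester u] a value of [fB], hence no divisor of [d], and [g u = 1] makes it a value of
       [fA], hence a divisor; [f] says the opposite. *)
    set (g u := if f (sylvester u) then 0 else 1).
    destruct (ct g) as (p & _ & _ & Hp).
    destruct (nth_form_surj p) as [u <-].
    specialize (Hp u). change (prv Q (diag (g u) u)) in Hp. unfold g in Hp.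
    destruct (f (sylvester u)) eqn:E.
    + destruct (enum_diag_complete 0 0 sylvester u Hp) as [k Hk].
      apply (Hsep k). unfold fB. rewrite Hk. now apply Hdiv.
    + destruct (enum_diag_complete 1 1 sylvester u Hp) as [k Hk].
      enough (f (sylvester u) = true) by congruence.
      apply Hdiv. rewrite <- Hk. apply (Hsep k).
Qed.
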